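(* Let $n\ge 2$. There exist a scalar product on $\mathbb{R}^{\binom{n}{2}}$ and a decomposition $\mathbb{R}^{\binom{n}{2}} = V_n \perp V_{n-1}\perp\cdots\perp V_2$ into linear subspaces that are pairwise orthogonal with respect to this scalar product, such that for every $2\le i\le n$: (1) $\dim V_i = i-1$; (2) the orthogonal projection of the $n$-th linear ordering polytope $P_n$ onto $V_i$ is (affinely isomorphic to) the $i$-th permutahedron.
   Context: $S_n$ is the symmetric group on $\{1,\dots,n\}$. For $\pi\in S_n$ and $1\le i<j\le n$ set $k_{ij}(\pi)=1$ if $\pi(i)>\pi(j)$ and $k_{ij}(\pi)=0$ if $\pi(i)<\pi(j)$. The $n$-th linear ordering polytope $P_n$ is the convex hull in $\mathbb{R}^{\binom n2}$ of the $n!$ vectors $p_\pi := (k_{ij}(\pi))_{1\le i<j\le n}$, $\pi\in S_n$. The $m$-th permutahedron is the convex hull in $\mathbb{R}^m$ of the $m!$ points $(\pi(1),\dots,\pi(m))$, $\pi\in S_m$. Two polytopes are affinely isomorphic if there is an affine bijection between them (a bijection that is the restriction of an affine map between their affine hulls). *)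

(* Defs.v *)
From HB Require Import structures.
From mathcomp Require Import all_boot all_order all_fingroup all_algebra.
From mathcomp Require Import boolp classical_sets functions.
From mathcomp Require Import reals topology convex.

Set Implicit Arguments.
Unset Strict Implicit.
Unset Printing Implicit Defensive.

Import Order.TTheory GRing.Theory Num.Theory.

Local Open Scope classical_set_scope.
Local Open Scope ring_scope.

Definition convex_hull (R : numDomainType) (U : lmodType R) (A : set U) :
    set U :=
  smallest (@convex_set R U) A.

(* Closure under lines is closure under all affine combinations, and
   preserving points of lines is preserving all affine combinations, since
   the field R has characteristic 0. *)
Definition affine_set (R : numFieldType) (U : lmodType R) (A : set U) :=
  forall (x y : U) (t : R), A x -> A y -> A ((1 - t) *: x + t *: y).

Definition affine_hull (R : numFieldType) (U : lmodType R) (A : set U) :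
    set U :=
  smallest (@affine_set R U) A.

Definition affine_on (R : numFieldType) (U W : lmodType R) (A : set U)
    (f : U -> W) :=
  forall (x y : U) (t : R), A x -> A y ->
    f ((1 - t) *: x + t *: y) = (1 - t) *: f x + t *: f y.

(* Only the values of f on the affine hull of P matter. *)
Definition affinely_isomorphic (R : numFieldType) (U W : lmodType R)
    (P : set U) (Q : set W) :=
  exists f : U -> W,
    [/\ {homo f : x / affine_hull P x >-> affine_hull Q x},
        affine_on (affine_hull P) f
      & set_bij P Q f].

(* The projection onto V along its orthogonal complement. *)
Definition orthproj (R : numFieldType) (E : vectType R)
    (form : {dot E for idfun}) (V : {vspace E}) : 'End(E) :=
  daddv_pi V (orthov form V).

(* {ffun pairs n -> R^o} is R^(n choose 2), see card_pairs. *)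
Notation pairs n := {p : 'I_n * 'I_n | (p.1 < p.2)%N}.

Lemma card_pairs (n : nat) : #|{: pairs n}| = 'C(n, 2).
Proof.
rewrite card_sig -sum1_card -(pair_big_dep predT (fun i j : 'I_n => (i < j)%N)
  (fun _ _ => 1%N)) /= (exchange_big_dep predT) //= -bin2_sum big_mkord.
apply: eq_bigr => j _; rewrite -(big_ord_widen n (fun=> 1%N)) ?(ltnW (ltn_ord j)) //.
by rewrite sum1_card card_ord.
Qed.

Definition inversion_vector (R : numDomainType) (n : nat) (s : 'S_n) :
    {ffun pairs n -> R^o} :=
  [ffun p : pairs n => (s (val p).2 < s (val p).1)%N%:R : R^o].

Definition linear_ordering_polytope (R : numDomainType) (n : nat) :
    set {ffun pairs n -> R^o} :=
  convex_hull (range (@inversion_vector R n)).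
Arguments linear_ordering_polytope : clear implicits.

(* 'S_m acts on {0, .., m-1}, hence the successor. *)
Definition permutahedron (R : numDomainType) (m : nat) : set 'rV[R]_m :=
  convex_hull (range (fun s : 'S_m => \row_(i < m) (s i).+1%:R)).
Arguments permutahedron : clear implicits.

(* Main.v *)
(* For [i <= n], counting inversions shows that the rank of [j] in the pattern
   induced by a permutation on the first [i] positions is an affine function of
   the inversion vector, namely [j] plus the linear form [score i x j]: so
   [score i], up to translation, maps the linear ordering polytope onto the
   [i]-th permutahedron. It takes values in the hyperplane of vectors of sum 0
   in R^i, and, since [x_(j,k) = score k.+1 x j - score k x j] with 0-based
   indices, the scores for 2 <= i <= n jointly identify R^(n choose 2) with the
   direct sum of these hyperplanes. Pull back the standard scalar product of the
   direct sum, and take for [V i] the preimage of the [i]-th summand. *)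

Require Import Defs.
From HB Require Import structures.
From mathcomp Require Import all_boot all_order all_fingroup all_algebra.
From mathcomp Require Import boolp classical_sets functions.
From mathcomp Require Import reals topology convex.
From mathcomp Require Import interval_inference zify ring.

Set Implicit Arguments.
Unset Strict Implicit.
Unset Printing Implicit Defensive.

Import Order.TTheory GRing.Theory Num.Theory.

Local Open Scope classical_set_scope.
Local Open Scope ring_scope.

(** * Scores of a vector, and the recovery of the vector from them *)

Section Scores.

Variables (R : realFieldType) (n : nat).
Local Notation E := {ffun pairs n -> R^o}.
Implicit Types (x u v : E) (w : nat -> R).

(* Zero unless [j < k < n]. *)
Definition entry x (j k : nat) : R :=
  \sum_(p : pairs n | ((val p).1 == j :> nat) && ((val p).2 == k :> nat)) x p.

(** Extend [x] to an antisymmetric matrix: this is the sum of row [j] in its leading [i] by [i]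
    block. *)
Definition score (i : nat) x (j : nat) : R :=
  \sum_(0 <= k < i) (entry x j k - entry x k j).

Lemma entryE x (p : pairs n) : entry x (val p).1 (val p).2 = x p.
Proof.
by rewrite /entry (big_pred1 p).
Qed.

Lemma entry_eq0 x j k : ~~ (j < k)%N -> entry x j k = 0.
Proof.
move=> jk; rewrite /entry big_pred0 // => p.
by apply: contraNF jk => /andP[/eqP <- /eqP <-]; apply: (valP p).
Qed.

Lemma entryP a x y j k : entry (a *: x + y) j k = a * entry x j k + entry y j k.
Proof.
rewrite /entry mulr_sumr -big_split /=.
by apply: eq_bigr => p _; rewrite !ffunE.
Qed.

Lemma entry_ext x y :
  (forall j k, (j < k < n)%N -> entry x j k = entry y j k) -> x = y.
Proof.
move=> xy; apply/ffunP => p; rewrite -!entryE; apply: xy.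
by rewrite (valP p) /=.
Qed.

Lemma scoreP i a x y j : score i (a *: x + y) j = a * score i x j + score i y j.
Proof.
rewrite /score mulr_sumr -big_split /=.
by apply: eq_bigr => k _; rewrite !entryP; ring.
Qed.

Lemma scoreZ i a x j : score i (a *: x) j = a * score i x j.
Proof.
rewrite -[a *: x]addr0 scoreP -(addNr x) -scaleN1r scoreP.
by rewrite mulN1r addNr addr0.
Qed.

Lemma scoreS i x j : score i.+1 x j = score i x j + (entry x j i - entry x i j).
Proof. by rewrite /score big_nat_recr. Qed.

(** The entries of an antisymmetric matrix cancel in pairs. *)
Lemma sum_score i x : \sum_(0 <= j < i) score i x j = 0.
Proof.
rewrite /score; under eq_bigr do rewrite sumrB.
by rewrite sumrB exchange_big /= subrr.
Qed.

Lemma score1 x j : (j < 1)%N -> score 1 x j = 0.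
Proof. by case: j => // _; rewrite /score big_nat1 subrr. Qed.

(* The preimage, under the joint map [x |-> (score i x)_i], of the family whose
   only nonzero member is [w], at index [i]: it is read off
   [entry x j k = score k.+1 x j - score k x j] for [j < k]. *)
Definition unscore (i : nat) w : E :=
  [ffun p : pairs n => (((val p).2.+1 == i)%:R - ((val p).2 == i :> nat)%:R)
             * w (val p).1 : R^o].

Lemma entry_unscore i w j k : (j < k < n)%N ->
  entry (unscore i w) j k = ((k.+1 == i)%:R - (k == i)%:R) * w j.
Proof.
case/andP=> jk kn; pose p : 'I_n * 'I_n := (Ordinal (ltn_trans jk kn), Ordinal kn).
by rewrite -[j]/(val p.1) -[k]/(val p.2) (entryE _ (exist _ p jk)) ffunE.
Qed.

(** Only the columns [i - 1] and [i] of [unscore i w] can be nonzero, and above the diagonal their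
    rows are all below [i]. *)
Lemma eq_unscore i w w' : (forall j, (j < i)%N -> w j = w' j) ->
  unscore i w = unscore i w'.
Proof.
move=> ww'; apply/ffunP => p; rewrite !ffunE.
have [ji|ij] := ltnP (val p).1 i; first by rewrite ww'.
have ik := leq_ltn_trans ij (valP p).
by rewrite !gtn_eqF ?subrr ?mul0r // ltnW.
Qed.

Lemma score_unscore (i m : nat) w j : (i <= n)%N -> (m <= n)%N ->
  \sum_(0 <= k < m) w k = 0 -> (j < i)%N ->
  score i (unscore m w) j = (i == m)%:R * w j.
Proof.
move=> iN mN w0 ji; rewrite /score (big_cat_nat (n := j)) ?(ltnW ji) //=.
rewrite (big_ltn (m := j)) // subrr add0r.
rewrite (eq_big_nat _ _ (F2 := fun k =>
  - (((j.+1 == m)%:R - (j == m)%:R) * w k))); last first.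
  by move=> k kj; rewrite entry_eq0 ?entry_unscore; [rewrite sub0r|lia|lia].
rewrite sumrN -mulr_sumr.
rewrite (eq_big_nat (m := j.+1) _ _ (F2 := fun k =>
  ((k.+1 == m)%:R - (k == m)%:R) * w j)); last first.
  by move=> k kj; rewrite entry_unscore ?entry_eq0; [rewrite subr0|lia|lia].
(* The columns right of [j] telescope to [(i == m) - (j.+1 == m)], times [w j]. *)
rewrite -mulr_suml telescope_sumr //.
(* Column [j] contributes only if [m] is [j.+1] or [j]. In the first case the partial sum of [w] is
   [- w j], which cancels the unwanted term; in the second it is the full sum, 0. *)
have [jm|jm] := eqVneq j.+1 m.
  have -> : \sum_(0 <= k < j) w k = - w j.
    by apply/eqP; rewrite -addr_eq0 -big_nat_recr //= jm w0.
  by rewrite -jm ltn_eqF //; case: (i == _) => /=; ring.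
have [jm'|jm'] := eqVneq j m; last by case: (i == _) => /=; ring.
by rewrite -jm' in w0 *; rewrite w0; case: (i == _) => /=; ring.
Qed.

Lemma entry_score x j k : (j < k)%N -> entry x j k = score k.+1 x j - score k x j.
Proof. by move=> jk; rewrite scoreS (@entry_eq0 _ k j) ; [ring|lia]. Qed.

(** At the entry [(j, k)] only the indices [i = k.+1] and [i = k] contribute, and they give the
    difference of scores in [entry_score]. *)
Lemma sum_unscore x : \sum_(2 <= i < n.+1) unscore i (score i x) = x.
Proof.
apply: entry_ext => j k /andP[jk kn].
(* The index [i = k] can be 1, outside the range of the sum; the terms below 2 vanish, so the sum
   may start at 0. *)
have un0 (i : nat) : (i < 2)%N -> unscore i (score i x) = 0.
  move=> i2; rewrite (@eq_unscore _ _ (fun=> 0)).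
    by apply/ffunP => p; rewrite !ffunE mulr0.
  by case: i i2 => [|[|//]] // _ j' /score1.
have -> : \sum_(2 <= i < n.+1) unscore i (score i x)
          = \sum_(0 <= i < n.+1) unscore i (score i x).
  rewrite [RHS]big_ltn // [in RHS]big_ltn; last lia.
  by rewrite !un0 // !add0r.
have entry_sum (r : seq nat) (F : nat -> E) :
    entry (\sum_(i <- r) F i) j k = \sum_(i <- r) entry (F i) j k.
  rewrite /entry exchange_big /=; apply: eq_bigr => p _.
  by rewrite sum_ffunE.
rewrite entry_sum; under eq_bigr do rewrite entry_unscore ?jk ?kn // mulrBl.
have pickE (m : nat) : (m < n.+1)%N ->
    \sum_(0 <= i < n.+1) (m == i)%:R * score i x j = score m x j.
  move=> mn; rewrite (bigD1_seq m) ?mem_index_iota ?iota_uniq //= eqxx mul1r.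
  by rewrite big1 ?addr0 // => i im; rewrite eq_sym (negPf im) mul0r.
by rewrite sumrB !pickE ?entry_score //; lia.
Qed.

Lemma score_inj x :
  (forall i j, (2 <= i <= n)%N -> (j < i)%N -> score i x j = 0) -> x = 0.
Proof.
move=> x0; rewrite -(sum_unscore x) big_nat big1 // => i i2.
rewrite (@eq_unscore _ _ (fun=> 0)); last by move=> j; apply: x0; lia.
by apply/ffunP => p; rewrite !ffunE mulr0.
Qed.

End Scores.

(** * The scalar product *)

Section ScoreForm.

Variables (R : realFieldType) (n : nat).
Local Notation E := {ffun pairs n -> R^o}.
Implicit Types (u v x : E).

Definition score_form u v : R :=
  \sum_(2 <= i < n.+1) \sum_(0 <= j < i) score i u j * score i v j.

Fact score_form_sym u v : score_form u v = (-1) ^+ false * idfun (score_form v u).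
Proof.
rewrite expr0 mul1r /=; apply: eq_bigr => i _.
by apply: eq_bigr => j _; rewrite mulrC.
Qed.

Fact score_form_bilinear : bilinear_for *%R (idfun \; *%R) score_form.
Proof.
have linl v : GRing.linear_for *%R (score_form^~ v).
  move=> a u u'; rewrite /score_form mulr_sumr -big_split; apply: eq_bigr => i _.
  rewrite mulr_sumr -big_split; apply: eq_bigr => j _ /=.
  by rewrite scoreP mulrDl mulrA.
split=> // u a v v'; have := linl u a v v'.
by rewrite !(score_form_sym _ u) /= !expr0 !mul1r.
Qed.

Fact score_form_gt0 u : u != 0 -> 0 < score_form u u.
Proof.
have ge0 i : 0 <= \sum_(0 <= j < i) score i u j * score i u j.
  by apply: sumr_ge0 => j _; rewrite -expr2 sqr_ge0.
apply: contraNT; rewrite lt_def sumr_ge0 // andbT negbK psumr_eq0 // => /allP form0.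
apply/eqP/score_inj => i j iN ji; apply/eqP; rewrite -sqrf_eq0 expr2.
have := form0 i; rewrite mem_index_iota ltnS iN psumr_eq0 => [/(_ isT)/allP/(_ j)|j' _].
  by rewrite mem_index_iota ji; apply.
by rewrite -expr2 sqr_ge0.
Qed.

HB.instance Definition _ :=
  @bilinear_isBilinear.Build R E E R *%R (idfun \; *%R)
    score_form score_form_bilinear.
HB.instance Definition _ :=
  isHermitianSesquilinear.Build R E false idfun score_form score_form_sym.
HB.instance Definition _ := isDotProduct.Build R E score_form score_form_gt0.

Definition score_dot : {dot E for idfun} := score_form.

End ScoreForm.

(** * Orthogonal projections *)

Lemma capv_orthov (R : numFieldType) (U : vectType R)
    (form : {dot U for idfun}) (V : {vspace U}) : (V :&: orthov form V = 0)%VS.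
Proof.
apply/eqP; rewrite -subv0; apply/subvP => u; rewrite memv_cap memv0.
move=> /andP[uV /mem_orthovP/(_ u uV) uu0]; apply/negPn/negP.
by move=> /(neq0_dnorm_gt0 (s := form)); rewrite uu0 ltxx.
Qed.

Lemma orthprojD (R : numFieldType) (U : vectType R)
    (form : {dot U for idfun}) (V : {vspace U}) (u v : U) :
  u \in V -> v \in orthov form V -> orthproj form V (u + v) = u.
Proof.
move=> uV vV; have dV := capv_orthov form V; rewrite /orthproj linearD /=.
rewrite daddv_pi_id // [X in u + X](_ : _ = 0) ?addr0 //.
(* The two components of [v] add up to [v], and the one along [orthov form V] is already [v]. *)
apply: (addIr v); rewrite add0r -{2}(@daddv_pi_id _ _ (orthov form V) V v) 1?capvC //.
by rewrite daddv_pi_add // (subvP (addvSr V _)).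
Qed.

(** * The orthogonal decomposition *)

Section ScoreSpaces.

Variables (R : realFieldType) (n : nat).
Local Notation E := {ffun pairs n -> R^o}.
Implicit Types (u v x : E).

(* Appends to [y] the coordinate that makes the sum 0. *)
Definition extend_sum0 m (y : 'rV[R]_m) (j : nat) : R :=
  \sum_(k < m) y 0 k * ((k == j :> nat)%:R - (m == j)%:R).

Lemma extend_sum0_ord m (y : 'rV[R]_m) (k : 'I_m) : extend_sum0 y k = y 0 k.
Proof.
rewrite /extend_sum0 (bigD1 k) //= eqxx gtn_eqF ?ltn_ord // subr0 mulr1.
by rewrite big1 ?addr0 // => k'; rewrite -val_eqE => /negPf ->; rewrite subr0 mulr0.
Qed.

Lemma sum_extend_sum0 i (y : 'rV[R]_i.-1) : (0 < i)%N ->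
  \sum_(0 <= j < i) extend_sum0 y j = 0.
Proof.
case: i y => // m y _ /=.
rewrite exchange_big big1 // => k _; rewrite -mulr_sumr sumrB.
rewrite (bigD1_seq (k : nat)) ?iota_uniq ?mem_index_iota ?ltnS //=;
  last exact/ltnW.
rewrite [X in _ - X](bigD1_seq m) ?iota_uniq ?mem_index_iota ?leqnn //=.
by rewrite !eqxx !big1 ?addr0 ?subrr ?mulr0 // => j; rewrite eq_sym => /negPf ->.
Qed.

Lemma extend_sum0_unique m (w : nat -> R) j : \sum_(0 <= k < m.+1) w k = 0 ->
  (j < m.+1)%N -> extend_sum0 (\row_(k < m) w k) j = w j.
Proof.
move=> w0; have wE (k : nat) : (k < m)%N -> extend_sum0 (\row_(k < m) w k) k = w k.
  by move=> km; rewrite (extend_sum0_ord _ (Ordinal km)) mxE.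
rewrite ltnS leq_eqVlt => /orP[/eqP ->|/wE //].
apply: (addrI (\sum_(0 <= k < m) w k)); rewrite -big_nat_recr //= w0.
apply: etrans (sum_extend_sum0 (i := m.+1) (\row_(k < m) w k) isT).
rewrite big_nat_recr //=; congr (_ + _).
by apply: eq_big_nat => k /andP[_ km]; rewrite wE.
Qed.

(** The [i.-1] free coordinates parametrize the sum-zero hyperplane of R^i, so the dimension of the
    image follows from injectivity. *)
Definition score_embed i (y : 'rV[R]_i.-1) : E := unscore n i (extend_sum0 y).

Fact score_embed_linear i : linear (@score_embed i).
Proof.
move=> a y z; apply/ffunP => p; rewrite !ffunE.
rewrite [extend_sum0 _ _](_ : _ =
    a * extend_sum0 y (val p).1 + extend_sum0 z (val p).1).
  by rewrite [_ *: _]mulrCA mulrDr; ring.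
rewrite /extend_sum0 mulr_sumr -big_split /=.
by apply: eq_bigr => k _; rewrite !mxE; ring.
Qed.

HB.instance Definition _ i := @GRing.isLinear.Build R 'rV[R]_i.-1 E *:%R
  (@score_embed i) (@score_embed_linear i).

Definition score_space i : {vspace E} := limg (linfun (@score_embed i)).

Lemma score_of_space i m u j : (0 < i <= n)%N -> (m <= n)%N -> (j < m)%N ->
  u \in score_space i -> i != m -> score m u j = 0.
Proof.
move=> /andP[i0 iN] mN jm /memv_imgP[y _ ->] im.
by rewrite lfunE (score_unscore mN iN (sum_extend_sum0 y i0) jm) eq_sym (negPf im) mul0r.
Qed.

Lemma unscore_in_space i x : (0 < i)%N -> unscore n i (score i x) \in score_space i.
Proof.
move=> i0; apply/memv_imgP; exists (\row_(k < i.-1) score i x k); first exact: memvf.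
rewrite lfunE /= /score_embed; apply: eq_unscore => j ji.
by rewrite extend_sum0_unique // prednK // sum_score.
Qed.

Lemma dim_score_space i : (0 < i <= n)%N -> \dim (score_space i) = i.-1.
Proof.
move=> /andP[i0 iN]; rewrite limg_dim_eq; first by rewrite dimvf /dim /= mul1n.
apply/eqP; rewrite capfv -subv0; apply/subvP => y; rewrite memv_ker memv0 lfunE /=.
move=> /eqP y0; apply/eqP/rowP => k; rewrite mxE -extend_sum0_ord.
(* For injectivity: column [i.-1] of [score_embed y] displays the coordinates of [y]. *)
have := entry_unscore i (extend_sum0 y) (j := k) (k := i.-1) (n := n).
rewrite ltn_ord prednK // iN => /(_ isT); rewrite -/(score_embed y) y0.
rewrite (ltn_eqF (m := i.-1)) ?prednK // eqxx subr0 mul1r => <-.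
by rewrite /entry big1 // => p _; rewrite ffunE.
Qed.

Lemma sum_score_space : (\sum_(2 <= i < n.+1) score_space i)%VS = fullv.
Proof.
apply/eqP; rewrite eqEsubv subvf /=; apply/subvP => x _.
rewrite -(sum_unscore x) !big_nat; elim/big_ind2: _ => [|U u V v uU vV|i /andP[i2 _]].
- by rewrite mem0v.
- exact: memv_add.
- by rewrite unscore_in_space // ltnW.
Qed.

(** The spaces span everything, and their dimensions 1, ..., n - 1 add up to the binomial
    coefficient. *)
Lemma directv_score_space : directv (\sum_(2 <= i < n.+1) score_space i).
Proof.
apply/directvP; rewrite /= sum_score_space dimvf /dim /= card_pairs muln1.
transitivity (\sum_(2 <= i < n.+1) i.-1)%N; last first.
  by apply: eq_big_nat => i i2; rewrite dim_score_space //; lia.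
rewrite -bin2_sum big_add1 /=; case: n => [|m]; first by rewrite !big_geq.
by rewrite big_ltn.
Qed.

(** An index [m] differs from [i] or from [j], so one factor of each product of scores vanishes. *)
Lemma score_space_orth i j u v : (0 < i <= n)%N -> (0 < j <= n)%N -> i != j ->
  u \in score_space i -> v \in score_space j -> score_form u v = 0.
Proof.
move=> iN jN ij ui vj; rewrite /score_form big_nat big1 // => m /andP[m2 mn].
rewrite big_nat big1 // => k /andP[_ km].
have [im|im] := eqVneq i m; last by rewrite (score_of_space iN _ km ui) ?mul0r.
by rewrite (score_of_space jN _ km vj) ?mulr0 // -im eq_sym.
Qed.

(** In the decomposition [sum_unscore] of [x], the [i]-th term lies in the space and the others are
    orthogonal to it. *)
Lemma orthproj_score_space i x : (2 <= i <= n)%N ->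
  orthproj (score_dot R n) (score_space i) x = unscore n i (score i x).
Proof.
move=> /andP[i2 iN].
rewrite -{1}(sum_unscore x) (bigD1_seq i) ?mem_index_iota ?iota_uniq ?i2 //=.
apply: orthprojD; first by rewrite unscore_in_space // ltnW.
rewrite big_nat_cond rpred_sum // => j /andP[/andP[j2 jn] ji].
apply/mem_orthovP => v vi; apply: (@score_space_orth j i) => //; first lia.
  lia.
by rewrite unscore_in_space // ltnW.
Qed.

End ScoreSpaces.

(** * Affine maps, convex hulls and affine isomorphisms *)

Section AffineMaps.

Variables (R : numFieldType) (U W : lmodType R).
Implicit Types (A P : set U) (f : U -> W).

Lemma convex_hull_conv (T : lmodType R) (A : set T) (l : {i01 R})
    (x y : convex_lmodType T) :
  convex_hull A x -> convex_hull A y -> convex_hull A (conv l x y).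
Proof.
move=> xA yA B [cB AB]; apply/set_mem/cB; apply/mem_set.
  exact: xA.
exact: yA.
Qed.

Lemma affine_affine_hull (T : lmodType R) (A : set T) : affine_set (affine_hull A).
Proof. by move=> x y t xA yA B [aB AB]; exact: (aB _ _ _ (xA _ _) (yA _ _)). Qed.

Lemma image_convex_hull f A : affine_on setT f ->
  f @` convex_hull A = convex_hull (f @` A).
Proof.
move=> fa.
have fconv (x y : U) (l : {i01 R}) :
    f (conv l (x : convex_lmodType U) y) = conv l (f x : convex_lmodType W) (f y).
  (* [conv l x y] puts the weight [l] on [x], while [affine_on] puts [t] on its second point: hence
     the swap. *)
  have := fa y x l%:num Logic.I Logic.I.
  by rewrite addrC [RHS]addrC.
apply/seteqP; split.
  move=> _ [x xA <-]; move: x xA; apply: smallest_sub => /=.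
    move=> x y l /set_mem xA /set_mem yA; apply/mem_set.
    by rewrite /= fconv; apply: convex_hull_conv.
  by move=> x xA; apply: sub_gen_smallest; exists x.
apply: smallest_sub; last first.
  by move=> _ [x xA <-]; exists x => //; apply: sub_gen_smallest.
move=> _ _ l /set_mem[x xA <-] /set_mem[y yA <-]; apply/mem_set; rewrite -fconv.
by exists (conv l (x : convex_lmodType U) y) => //; apply: convex_hull_conv.
Qed.

Lemma affine_isomorphism f P (Q : set W) : affine_on setT f ->
  {in P &, injective f} -> f @` P = Q -> affinely_isomorphic P Q.
Proof.
move=> fa fi fPQ; exists f; split.
- apply: smallest_sub => [x y t xP yP|x xP] /=.
    by rewrite /= fa //; apply: affine_affine_hull.
  by apply: sub_gen_smallest; rewrite -fPQ; exists x.
- by move=> x y t _ _; apply: fa.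
- by split; rewrite -?fPQ //; move=> x xP; exists x.
Qed.

End AffineMaps.

(** * Ranks and extensions of permutations *)

Lemma perm_rank m (g : 'I_m -> nat) : injective g ->
  exists t : 'S_m, forall j, t j = (\sum_(k < m) (g k < g j)%N)%N :> nat.
Proof.
move=> gI.
(* Ranks increase strictly with [g], so they are distinct; they are below [m] because no index
   counts itself. *)
have rank_lt (j j' : 'I_m) : (g j < g j')%N ->
    (\sum_(k < m) (g k < g j) < \sum_(k < m) (g k < g j'))%N.
  move=> jj; rewrite (bigD1 j) //= [X in (_ < X)%N](bigD1 j) //= ltnn jj add0n ltnS.
  by apply: leq_sum => k _; have := @ltn_trans (g j) (g k) (g j'); lia.
have rank_ltm j : (\sum_(k < m) (g k < g j) < m)%N.
  rewrite (bigD1 j) //= ltnn add0n.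
  apply: leq_ltn_trans (_ : (\sum_(k < m | k != j) 1 < m)%N).
    by apply: leq_sum => k _; case: (_ < _)%N.
  by rewrite sum1_card cardC1 card_ord ltn_predL (leq_ltn_trans _ (ltn_ord j)).
have tI : injective (fun j => Ordinal (rank_ltm j)).
  move=> j j' /(congr1 val) /= jj; apply: gI.
  by case: (ltngtP (g j) (g j')) => // /rank_lt; rewrite jj ltnn.
by exists (perm tI) => j; rewrite permE.
Qed.

Lemma sum_ord_lt m a : (a <= m)%N -> (\sum_(k < m) (k < a) = a)%N.
Proof.
move=> am; rewrite -[RHS](card_ord a) -sum1_card (big_ord_widen m (fun=> 1%N)) // [RHS]big_mkcond.
by apply: eq_bigr => k _; case: ifP.
Qed.

Lemma perm_rankE m (t : 'S_m) j : (\sum_(k < m) (t k < t j) = t j)%N.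
Proof.
rewrite (reindex_perm t^-1%g) /=; under eq_bigr do rewrite permKV.
exact/sum_ord_lt/ltnW.
Qed.

Lemma perm_widen m n (mn : (m <= n)%N) (t : 'S_m) :
  exists s : 'S_n, forall j, s (widen_ord mn j) = t j :> nat.
Proof.
(* Extend [t] by fixing every index from [m] on. *)
pose f (k : 'I_n) := if insub (k : nat) is Some j then widen_ord mn (t j) else k.
have fI : injective f.
  move=> k l; rewrite /f.
  case: insubP => [j _ jk|km]; case: insubP => [j' _ jl|lm] /(congr1 val) /= jj.
  - apply: val_inj; rewrite /= -jk -jl; congr val; apply: (@perm_inj _ t).
    exact: val_inj.
  - by rewrite -jj ltn_ord in lm.
  - by rewrite jj ltn_ord in km.
  - exact: val_inj.
exists (perm fI) => j; rewrite permE /f /=.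
rewrite (insubT (fun k => k < m)%N (ltn_ord j)) /=.
by congr (nat_of_ord (t _)); apply: val_inj.
Qed.

(** * From the linear ordering polytope to permutahedra *)

Section LinearOrdering.

Variables (R : realFieldType) (n : nat).

Lemma entry_inversion (s : 'S_n) (a b : 'I_n) :
  entry (inversion_vector R s) a b = ((a < b) && (s b < s a))%N%:R.
Proof.
have [ab|ba] := ltnP a b; last by rewrite entry_eq0 // -leqNgt.
pose p : pairs n := exist _ (a, b) ab.
by rewrite -[a]/((val p).1) -[b]/((val p).2) entryE ffunE.
Qed.

Lemma score_inversion i (iN : (i <= n)%N) (s : 'S_n) (j : 'I_i) :
  score i (inversion_vector R s) j + j%:R
  = (\sum_(k < i) (s (widen_ord iN k) < s (widen_ord iN j)))%N%:R.
Proof.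
(* Write [j] as the number of [k < j] and compare termwise: for [k < j], 1 minus the indicator of an
   inversion is the indicator that [s k < s j]. *)
rewrite /score big_mkord -[in j%:R](sum_ord_lt (ltnW (ltn_ord j))) !natr_sum.
rewrite -big_split; apply: eq_bigr => k _ /=.
rewrite (entry_inversion s (widen_ord iN j) (widen_ord iN k)).
rewrite (entry_inversion s (widen_ord iN k) (widen_ord iN j)) /=.
have [jk|kj|/val_inj ->] := ltngtP j k; last by rewrite !ltnn subrr add0r.
- by rewrite subr0 addr0.
- rewrite sub0r; have [skj|sjk|/val_inj/perm_inj/(congr1 val)/= jk] :=
    ltngtP (s (widen_ord iN k)) (s (widen_ord iN j)).
  + by rewrite oppr0 add0r.
  + by rewrite addNr.
  + by rewrite jk ltnn in kj.
Qed.

Definition rank_map i (x : {ffun pairs n -> R^o}) : 'rV[R]_i :=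
  \row_(j < i) (score i x j + j.+1%:R).

Lemma rank_map_affine i : affine_on setT (rank_map i).
Proof.
by move=> x y t _ _; apply/rowP => j; rewrite !mxE scoreP scoreZ; ring.
Qed.

Lemma rank_map_polytope i : (i <= n)%N ->
  rank_map i @` linear_ordering_polytope R n = permutahedron R i.
Proof.
move=> iN; rewrite /linear_ordering_polytope image_convex_hull; last first.
  exact: rank_map_affine.
have rank_inv (s : 'S_n) (t : 'S_i) :
    (forall j, t j = (\sum_(k < i) (s (widen_ord iN k) < s (widen_ord iN j)))%N :> nat) ->
    rank_map i (inversion_vector R s) = \row_(j < i) (t j).+1%:R.
  move=> tE; apply/rowP => j; rewrite !mxE -addn1 natrD addrA score_inversion -tE.
  by rewrite -natrD addn1.
(* It remains to match the generating points: the pattern of [s] on the first [i] positions is a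
   permutation, and each permutation arises as the pattern of its extension. *)
congr convex_hull; apply/seteqP; split.
  move=> _ [_ [s _ <-] <-].
  have gI : injective (fun j : 'I_i => s (widen_ord iN j) : nat).
    by move=> j j' /val_inj/perm_inj/(congr1 val) /= /val_inj.
  by have [t tE] := perm_rank gI; exists t => //; rewrite (rank_inv s t).
move=> _ [t _ <-]; have [s sE] := perm_widen iN t.
exists (inversion_vector R s); first by exists s.
apply: rank_inv => j; rewrite -[LHS]perm_rankE.
by apply: eq_bigr => k _; rewrite !sE.
Qed.

Lemma projection_permutahedron i : (2 <= i <= n)%N ->
  affinely_isomorphic
    (orthproj (score_dot R n) (score_space R n i) @` linear_ordering_polytope R n)
    (permutahedron R i).
Proof.
move=> /andP[i2 iN].
have projE x : orthproj (score_dot R n) (score_space R n i) x = unscore n i (score i x).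
  by rewrite orthproj_score_space ?i2.
(* The projection preserves the scores of index [i], hence [rank_map i]; conversely, these scores
   determine the projected point. *)
apply: (affine_isomorphism (f := rank_map i)) (@rank_map_affine i) _ _.
  move=> _ _ /set_mem[x _ <-] /set_mem[y _ <-] /rowP xy.
  have scoreK z j : (j < i)%N ->
      score i (orthproj (score_dot R n) (score_space R n i) z) j = score i z j.
    by move=> ji; rewrite projE score_unscore ?sum_score // eqxx mul1r.
  rewrite !projE; apply: eq_unscore => j ji.
  by have := xy (Ordinal ji); rewrite !mxE /= !scoreK // => /addIr.
rewrite -(rank_map_polytope iN) image_comp; apply: eq_imagel => x _.
by apply/rowP => j; rewrite !mxE /= projE score_unscore ?sum_score // eqxx mul1r.
Qed.

End LinearOrdering.

Theorem corollary1 (R : realType) (n : nat) (hn : (2 <= n)%N) :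
  exists (form : {dot {ffun pairs n -> R^o} for idfun})
         (V : nat -> {vspace {ffun pairs n -> R^o}}),
    [/\ (\sum_(2 <= i < n.+1) V i)%VS = fullv,
        directv (\sum_(2 <= i < n.+1) V i)%VS,
        forall i j : nat, (2 <= i <= n)%N -> (2 <= j <= n)%N -> i != j ->
          forall u v, u \in V i -> v \in V j -> form u v = 0
      & forall i : nat, (2 <= i <= n)%N ->
          \dim (V i) = (i - 1)%N /\
          affinely_isomorphic
            (orthproj form (V i) @` linear_ordering_polytope R n)
            (permutahedron R i)].
Proof.
exists (score_dot R n), (score_space R n); split.
- exact: sum_score_space.
- exact: directv_score_space.
- move=> i j iN jN ij u v; apply: score_space_orth => //; lia.
- move=> i iN; split; last exact: projection_permutahedron.
  by rewrite dim_score_space ?subn1 //; lia.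
Qed.
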